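(* Let $\xi_1,\dots,\xi_n$ be independent random variables with $\mathbb{E}\xi_i=0$ for $i=1,\dots,n$ and $\sum_{i=1}^n\mathbb{E}\xi_i^2=1$. Let $W=\sum_{i=1}^n\xi_i$, and let $\Delta_1=\Delta_1(\xi_1,\dots,\xi_n)$ and $\Delta_2=\Delta_2(\xi_1,\dots,\xi_n)$ be two real-valued measurable functions of $\xi_1,\dots,\xi_n$. Put $$\beta_2=\sum_{i=1}^n\mathbb{E}\xi_i^2I(|\xi_i|>1),\qquad\beta_3=\sum_{i=1}^n\mathbb{E}|\xi_i|^3I(|\xi_i|\le1).$$ For each $1\le i\le n$, let $\Delta_1^{(i)}$ and $\Delta_2^{(i)}$ be random variables such that $\xi_i$ and $(\Delta_1^{(i)},\Delta_2^{(i)},W-\xi_i)$ are independent. Then $$\mathbb{P}(\Delta_1\le W\le\Delta_2)\le17(\beta_2+\beta_3)+5\,\mathbb{E}|\Delta_2-\Delta_1|+2\sum_{i=1}^n\sum_{j=1}^2\mathbb{E}\big|\xi_i\{\Delta_j-\Delta_j^{(i)}\}\big|.$$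
   Context: $I(\cdot)$ denotes the indicator function. Expectations of non-negative variables may be $+\infty$. *)

(* Defs.v *)
From HB Require Import structures.
From mathcomp Require Import all_boot all_order all_algebra.
From mathcomp Require Import all_classical all_reals all_analysis.

Set Implicit Arguments.
Unset Strict Implicit.
Unset Printing Implicit Defensive.

Import Order.TTheory GRing.Theory Num.Theory.
Import numFieldNormedType.Exports.

Local Open Scope classical_set_scope.
Local Open Scope ring_scope.

Section independence.
Context {d : measure_display} {T : measurableType d} {R : realType}.
Variable P : probability T R.

Definition mutually_independent {I : finType} {d' : measure_display}
    {T' : measurableType d'} (X : I -> T -> T') : Prop :=
  forall (J : {set I}) (B : I -> set T'), (forall i, measurable (B i)) ->
    P (\bigcap_(i in [set` J]) (X i @^-1` B i)) =
    (\prod_(i in J) P (X i @^-1` B i))%E.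

Definition independent_pair {d1 d2 : measure_display}
    {T1 : measurableType d1} {T2 : measurableType d2}
    (X : T -> T1) (Y : T -> T2) : Prop :=
  forall (A : set T1) (B : set T2), measurable A -> measurable B ->
    P (X @^-1` A `&` Y @^-1` B) = (P (X @^-1` A) * P (Y @^-1` B))%E.

End independence.

(* Main.v *)
(** Stein's method with a bounded random test function. Swapping the limits if
    necessary, let [a <= b] be the random limits, with [b - a] cut off at 1 (by
    Markov this costs [E|b - a|]), and put [l = b - a + 2 delta]. The function
      [F(a, b, w) = min(max(w - a + delta, 0), l) - h(w) l],
    where [h] rises linearly from 0 to 1 on [[-2, 2]], is 1-Lipschitz in [a] and
    in [b] and satisfies [w F(a, b, w) <= l / 4]: the tilt by [h] keeps
    [E(W F)] of order [E l], where the untilted ramp would give [E(|W| l)].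
    By independence [E(xi_i F(a_i, b_i, W - xi_i)) = 0], so [E(W F)] is, up to
    the leave-one-out errors, the sum of the
    [E(xi_i (F(a, b, W) - F(a, b, W - xi_i)))]. The ramp contributes at least
    [eta = \sum_i |xi_i| min(|xi_i|, delta)] on [a <= W <= b], where [eta] has
    variance at most [delta ^ 2] and mean at least 1/2 once
    [delta >= beta2 + beta3] and [beta2 <= 1/4]. The tilt loses at most
    [l / 4 * \sum_i xi_i ^ 2]; since [b - a <= 1] and the part of this sum with
    [|xi_i| <= 1] has variance at most [beta3], its expectation is again of
    order [E l + beta2 + beta3]. *)

Require Import Defs.
From HB Require Import structures.
From mathcomp Require Import all_boot all_order all_algebra.
From mathcomp Require Import all_classical all_reals all_analysis.
From mathcomp Require Import measurable_realfun ring lra.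

Set Implicit Arguments.
Unset Strict Implicit.
Unset Printing Implicit Defensive.

Import Order.TTheory GRing.Theory Num.Theory.
Import numFieldNormedType.Exports.

Local Open Scope classical_set_scope.
Local Open Scope ring_scope.

(** * The test function *)

Section test_function.
Context {R : realFieldType}.
Implicit Types a b w x y N delta : R.

Lemma minr_dist x x' y y' N : `|x - x'| <= N -> `|y - y'| <= N ->
  `|Num.min x y - Num.min x' y'| <= N.
Proof.
rewrite !ler_norml => /andP[? ?] /andP[? ?].
by case: (leP x y) => ?; case: (leP x' y') => ?; lra.
Qed.

Lemma maxr_dist x x' y y' N : `|x - x'| <= N -> `|y - y'| <= N ->
  `|Num.max x y - Num.max x' y'| <= N.
Proof.
rewrite !ler_norml => /andP[? ?] /andP[? ?].
by case: (leP x y) => ?; case: (leP x' y') => ?; lra.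
Qed.

(** Symmetric in the two limits, so that neither the given nor the left-out limits have to be
    ordered; the cut-off at 1 keeps the test function bounded. *)
Definition gap a b : R := Num.min `|b - a| 1.

(** For [delta >= 0], a line of slope 1 clamped at both ends: it starts to rise at distance [delta]
    left of the interval from [Num.min a b] to [Num.min a b + gap a b], and stops at distance
    [delta] right of it. *)
Definition ramp delta a b w : R :=
  Num.max 0 (Num.min (w - Num.min a b + delta) (gap a b + 2 * delta)).

Definition tilt w : R := Num.max 0 (Num.min (1 / 2 + w / 4) 1).

Definition tilted_ramp delta a b w : R :=
  ramp delta a b w - tilt w * (gap a b + 2 * delta).

Lemma gap_ge0 a b : 0 <= gap a b.
Proof. by rewrite /gap le_min normr_ge0 ler01. Qed.

Lemma gap_le1 a b : gap a b <= 1.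
Proof. by rewrite /gap ge_min lexx orbT. Qed.

Lemma gap_le a b : gap a b <= `|b - a|.
Proof. by rewrite /gap ge_min lexx. Qed.

Lemma gap_dist a b a' b' : `|gap a b - gap a' b'| <= `|a - a'| + `|b - b'|.
Proof.
apply: minr_dist; last by rewrite subrr normr0 addr_ge0.
apply: le_trans (ler_dist_dist _ _) _.
have -> : b - a - (b' - a') = (b - b') - (a - a') by ring.
by apply: le_trans (ler_normB _ _) _; rewrite addrC.
Qed.

Lemma min_dist a b a' b' :
  `|Num.min a b - Num.min a' b'| <= `|a - a'| + `|b - b'|.
Proof. by apply: minr_dist; rewrite ?lerDl ?lerDr. Qed.

Lemma max_dist a b a' b' :
  `|Num.max a b - Num.max a' b'| <= `|a - a'| + `|b - b'|.
Proof. by apply: maxr_dist; rewrite ?lerDl ?lerDr. Qed.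

(** This is the right end of the cut-off interval. Written as a minimum it is 1-Lipschitz in each
    limit, whereas adding the bounds for the two summands would double the constant. *)
Lemma min_add_gap a b :
  Num.min a b + gap a b = Num.min (Num.max a b) (Num.min a b + 1).
Proof.
rewrite /gap; case: (leP a b) => ab.
  rewrite ger0_norm ?subr_ge0//.
  by case: (leP (b - a)) => ?; case: (leP b) => ?; lra.
rewrite ltr0_norm ?subr_lt0// opprB.
by case: (leP (a - b)) => ?; case: (leP a) => ?; lra.
Qed.

Lemma min_add_gap_dist a b a' b' :
  `|(Num.min a b + gap a b) - (Num.min a' b' + gap a' b')| <=
    `|a - a'| + `|b - b'|.
Proof.
rewrite !min_add_gap; apply: minr_dist; first exact: max_dist.
have -> : Num.min a b + 1 - (Num.min a' b' + 1) = Num.min a b - Num.min a' b'.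
  by ring.
exact: min_dist.
Qed.

Lemma ramp_dist delta a b a' b' w :
  `|ramp delta a b w - ramp delta a' b' w| <= `|a - a'| + `|b - b'|.
Proof.
apply: maxr_dist; first by rewrite subrr normr0 addr_ge0.
apply: minr_dist.
  have -> : w - Num.min a b + delta - (w - Num.min a' b' + delta) =
    - (Num.min a b - Num.min a' b') by ring.
  by rewrite normrN min_dist.
have -> : gap a b + 2 * delta - (gap a' b' + 2 * delta) =
    gap a b - gap a' b' by ring.
exact: gap_dist.
Qed.

(** Subtracting a clamp from its upper value reflects it, with the right end of the interval as new
    base point. In this form the complement is 1-Lipschitz in each limit; bounding the two terms of
    the difference separately would give 2. *)
Lemma ramp_compl delta a b w : gap a b + 2 * delta - ramp delta a b w =
  Num.min (gap a b + 2 * delta)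
          (Num.max 0 (Num.min a b + gap a b + delta - w)).
Proof.
rewrite /ramp; set m := Num.min a b; set g := gap a b.
case: (leP (w - m + delta) (g + 2 * delta)) => ?.
  by case: (leP 0 (w - m + delta)) => ?; case: (leP 0 (m + g + delta - w)) => ?;
    case: leP => ?; lra.
by case: (leP 0 (g + 2 * delta)) => ?; case: (leP 0 (m + g + delta - w)) => ?;
    case: leP => ?; lra.
Qed.

Lemma ramp_compl_dist delta a b a' b' w :
  `|(gap a b + 2 * delta - ramp delta a b w) -
    (gap a' b' + 2 * delta - ramp delta a' b' w)| <= `|a - a'| + `|b - b'|.
Proof.
rewrite !ramp_compl; apply: minr_dist.
  have -> : gap a b + 2 * delta - (gap a' b' + 2 * delta) =
    gap a b - gap a' b' by ring.
  exact: gap_dist.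
apply: maxr_dist; first by rewrite subrr normr0 addr_ge0.
have -> : Num.min a b + gap a b + delta - w -
    (Num.min a' b' + gap a' b' + delta - w) =
  (Num.min a b + gap a b) - (Num.min a' b' + gap a' b') by ring.
exact: min_add_gap_dist.
Qed.

Lemma tilt_ge0 w : 0 <= tilt w.
Proof. by rewrite /tilt le_max lexx. Qed.

Lemma tilt_le1 w : tilt w <= 1.
Proof. by rewrite /tilt ge_max ler01 ge_min lexx orbT. Qed.

Lemma tilt_dist w w' : `|tilt w - tilt w'| <= `|w - w'| / 4.
Proof.
apply: maxr_dist; first by rewrite subrr normr0 divr_ge0.
apply: minr_dist; last by rewrite subrr normr0 divr_ge0.
have -> : 1 / 2 + w / 4 - (1 / 2 + w' / 4) = (w - w') / 4 by field.
by rewrite normrM [X in _ * X]ger0_norm// invr_ge0.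
Qed.

(** On [0, 2] the product is [1 / 4 - (w - 1) ^ 2 / 4]; beyond 2 the tilt is 1 and the product
    vanishes. [mul_tilt_ge] is the mirror image, with extremum at [w = - 1]. *)
Lemma mul_tilt_compl_le w : 0 <= w -> w * (1 - tilt w) <= 1 / 4.
Proof.
move=> w0; rewrite /tilt; case: (leP (1 / 2 + w / 4) 1) => ?.
  by case: (leP 0 (1 / 2 + w / 4)) => ?; [have := sqr_ge0 (w - 1); lra|lra].
by case: (leP 0 1) => ?; lra.
Qed.

Lemma mul_tilt_ge w : w <= 0 -> - (1 / 4) <= w * tilt w.
Proof.
move=> w0; rewrite /tilt; case: (leP (1 / 2 + w / 4) 1) => ?.
  by case: (leP 0 (1 / 2 + w / 4)) => ?; [have := sqr_ge0 (w + 1); lra|lra].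
by case: (leP 0 1) => ?; lra.
Qed.

Variable delta : R.
Hypothesis delta0 : 0 <= delta.

Let len0 a b : 0 <= gap a b + 2 * delta.
Proof. by rewrite addr_ge0 ?gap_ge0// mulr_ge0. Qed.

Lemma ramp_ge0 a b w : 0 <= ramp delta a b w.
Proof. by rewrite /ramp le_max lexx. Qed.

Lemma ramp_le a b w : ramp delta a b w <= gap a b + 2 * delta.
Proof. by rewrite /ramp ge_max len0 ge_min lexx orbT. Qed.

(* [tilted_ramp] is the combination, with weights [1 - tilt w] and [- tilt w],
   of [ramp] and [gap a b + 2 * delta - ramp], which are both 1-Lipschitz. *)
Lemma tilted_ramp_dist a b a' b' w :
  `|tilted_ramp delta a b w - tilted_ramp delta a' b' w| <=
    `|a - a'| + `|b - b'|.
Proof.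
have := ramp_dist delta a b a' b' w.
have := ramp_compl_dist delta a b a' b' w.
rewrite /tilted_ramp.
set u := ramp _ a b w; set u' := ramp _ a' b' w.
set v := gap a b + _; set v' := gap a' b' + _.
set N := `|a - a'| + `|b - b'| => Hv Hu.
have -> : u - tilt w * v - (u' - tilt w * v') =
  (1 - tilt w) * (u - u') - tilt w * ((v - u) - (v' - u')) by ring.
have h0 := tilt_ge0 w; have h1 := tilt_le1 w.
apply: le_trans (ler_normB _ _) _; rewrite !normrM (ger0_norm h0).
rewrite [`|1 - _|]ger0_norm ?subr_ge0//.
rewrite [leRHS](_ : _ = (1 - tilt w) * N + tilt w * N); last by ring.
by rewrite lerD// ler_wpM2l// subr_ge0.
Qed.

(** Makes the test function integrable whatever the moments of the left-out limits. *)
Lemma tilted_ramp_bound a b w : `|tilted_ramp delta a b w| <= 1 + 2 * delta.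
Proof.
have r0 := ramp_ge0 a b w; have r1 := ramp_le a b w; have g1 := gap_le1 a b.
have t0 := mulr_ge0 (tilt_ge0 w) (len0 a b).
have t1 := ler_wpM2r (len0 a b) (tilt_le1 w).
by rewrite /tilted_ramp ler_norml; apply/andP; split; lra.
Qed.

(** Let [l = gap a b + 2 * delta]. For [w >= 0] the ramp is at most [l], which leaves
    [w * (1 - tilt w) * l]; for [w < 0] it is at least 0, which leaves [- w * tilt w * l]. Both are
    at most [l / 4]. *)
Lemma mul_tilted_ramp_le a b w :
  w * tilted_ramp delta a b w <= (gap a b + 2 * delta) / 4.
Proof.
have g0 := len0 a b; have r0 := ramp_ge0 a b w; have r1 := ramp_le a b w.
rewrite /tilted_ramp mulrBr mulrA; have [w0|w0] := leP 0 w.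
  have h1 := ler_wpM2r g0 (mul_tilt_compl_le w0).
  have h2 := ler_wpM2l w0 r1.
  lra.
have h1 := ler_wpM2r g0 (mul_tilt_ge (ltW w0)).
have h2 := ler_wnM2l (ltW w0) r0.
lra.
Qed.

Lemma ramp_homo a b w w' : w <= w' -> ramp delta a b w <= ramp delta a b w'.
Proof.
move=> ww'; rewrite /ramp ge_max le_max lexx/= le_max.
apply/orP; right; rewrite le_min !ge_min lexx orbT andbT.
by apply/orP; left; lra.
Qed.

Lemma ramp_increment_ge0 a b w x :
  0 <= x * (ramp delta a b w - ramp delta a b (w - x)).
Proof.
have [x0|x0] := leP 0 x.
  by rewrite mulr_ge0// subr_ge0 ramp_homo// gerBl.
by rewrite mulr_le0 ?(ltW x0)// subr_le0 ramp_homo// lerBrDl gerDr ltW.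
Qed.

(** On this interval the ramp is linear at [w], with at least [delta] of room on either side before
    it flattens. A step of size [|x|] therefore moves it by at least [min(|x|, delta)], with the
    sign of [x]. *)
Lemma ramp_increment_ge a b w x :
  Num.min a b <= w <= Num.min a b + gap a b ->
  `|x| * Num.min `|x| delta <=
    x * (ramp delta a b w - ramp delta a b (w - x)).
Proof.
have := gap_ge0 a b; rewrite /ramp.
move: (Num.min a b) (gap a b) => m g g0 /andP[mw wg].
have -> : Num.max 0 (Num.min (w - m + delta) (g + 2 * delta)) = w - m + delta.
  by rewrite min_l ?max_r//; have := delta0; lra.
have d0 := delta0; have [x0|x0] := ger0P x.
  apply: ler_wpM2l => //.
  suff : Num.max 0 (Num.min (w - x - m + delta) (g + 2 * delta)) <=
    w - m + delta - Num.min x delta by lra.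
  rewrite ge_max ge_min.
  by case: (leP x delta) => ?; apply/andP; split;
    [|apply/orP; left| |apply/orP; left]; lra.
rewrite mulNr -mulrN; apply: ler_wnM2l; first exact: ltW.
suff : w - m + delta + Num.min (- x) delta <=
  Num.max 0 (Num.min (w - x - m + delta) (g + 2 * delta)) by lra.
rewrite le_max le_min; apply/orP; right.
by case: (leP (- x) delta) => ?; apply/andP; split; lra.
Qed.

Lemma tilt_increment_le w x : x * (tilt w - tilt (w - x)) <= x ^+ 2 / 4.
Proof.
apply: le_trans (ler_norm _) _; rewrite normrM.
apply: le_trans (ler_wpM2l (normr_ge0 x) (tilt_dist w (w - x))) _.
by rewrite opprB addrC subrK mulrA -expr2 real_normK ?num_real.
Qed.

End test_function.

(** * The pointwise inequality *)

Section pointwise_bound.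
Context {R : realFieldType}.
Implicit Types x delta : R.

(** Equal to [x ^ 2] while [|x| <= delta] and of linear growth beyond, so that second moments of [x]
    suffice to bound the variance. *)
Definition trunc_sq delta x : R := `|x| * Num.min `|x| delta.

Definition small_sq x : R := if `|x| <= 1 then x ^+ 2 else 0.

Definition large_sq x : R := if `|x| <= 1 then 0 else x ^+ 2.

Definition small_cube x : R := if `|x| <= 1 then `|x| ^+ 3 else 0.

Lemma small_sqD_large_sq x : small_sq x + large_sq x = x ^+ 2.
Proof.
by rewrite /small_sq /large_sq; case: ifP; rewrite ?addr0 ?add0r.
Qed.

Lemma small_sq_ge0 x : 0 <= small_sq x.
Proof. by rewrite /small_sq /large_sq; case: ifP; rewrite ?sqr_ge0. Qed.

Lemma large_sq_ge0 x : 0 <= large_sq x.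
Proof. by rewrite /small_sq /large_sq; case: ifP; rewrite ?sqr_ge0. Qed.

Lemma small_cube_ge0 x : 0 <= small_cube x.
Proof. by rewrite /small_cube; case: ifP; rewrite ?exprn_ge0. Qed.

(** A fourth power is at most the cube for absolute values up to 1. This is how [beta3] bounds the
    variance of the sum of the small squares. *)
Lemma small_sq_sqr_le x : small_sq x ^+ 2 <= small_cube x.
Proof.
rewrite /small_sq /small_cube; case: ifPn => x1; rewrite ?expr0n//.
rewrite -[x ^+ 2]real_normK ?num_real// -exprM.
by rewrite ler_wiXn2l.
Qed.

Lemma small_cube_le x : small_cube x <= x ^+ 2.
Proof.
rewrite /small_cube; case: ifPn => x1; rewrite ?sqr_ge0//.
by rewrite -[x ^+ 2]real_normK ?num_real// ler_wiXn2l.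
Qed.

Lemma trunc_sq_ge0 delta x : 0 <= delta -> 0 <= trunc_sq delta x.
Proof. by move=> d0; rewrite mulr_ge0// le_min normr_ge0. Qed.

Lemma trunc_sq_le delta x : trunc_sq delta x <= delta * `|x|.
Proof. by rewrite /trunc_sq [leRHS]mulrC ler_wpM2l// ge_min lexx orbT. Qed.

(** For [|x| <= 1] this is [min(y, delta) >= y - y ^ 2 / (4 * delta)] multiplied by [y = |x|], which
    for [y > delta] follows from a completed square; for [|x| > 1] the left side is 0. *)
Lemma trunc_sq_ge delta x : 0 < delta ->
  x ^+ 2 - large_sq x - small_cube x / (4 * delta) <= trunc_sq delta x.
Proof.
move=> d0; rewrite -(small_sqD_large_sq x) addrK.
rewrite /small_sq /small_cube; have [x1|x1] := leP `|x| 1; last first.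
  by rewrite mul0r subr0 trunc_sq_ge0// ltW.
rewrite -[x ^+ 2]real_normK ?num_real// /trunc_sq.
move: (normr_ge0 x); move: `|x| => y y0.
have [yd|yd] := leP y delta.
  by rewrite -expr2 gerBl divr_ge0 ?exprn_ge0// mulr_ge0// ltW.
rewrite -subr_ge0.
have -> : y * delta - (y ^+ 2 - y ^+ 3 / (4 * delta)) =
    y * (y / 2 - delta) ^+ 2 / delta by field; rewrite lt0r_neq0.
by rewrite divr_ge0 ?(ltW d0)// mulr_ge0 ?sqr_ge0.
Qed.

(** If [S1 <= 2] then [g * S1 <= 2 * g]. Otherwise [g <= 1] bounds the excess [g * (S1 - 2)] by
    [S1 - 2], and with [t = S1 - s >= S1 - 1] one has [S1 - 2 <= t - 1 <= t ^ 2 / 4]. The cut-off of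
    the gap at 1 serves here. *)
Lemma gap_mul_le g s S1 S2 : 0 <= g <= 1 -> s <= 1 -> 0 <= S2 ->
  g * (S1 + S2) <= 2 * g + (S1 - s) ^+ 2 / 4 + S2 :> R.
Proof.
move=> /andP[g0 g1] s1 S20.
have gS2 : g * S2 <= S2 by rewrite ler_piMl.
have sq := sqr_ge0 (S1 - s).
suff : g * S1 <= 2 * g + (S1 - s) ^+ 2 / 4 by lra.
have [S12|S12] := leP S1 2.
  by have := ler_wpM2l g0 S12; lra.
have : g * (S1 - 2) <= S1 - 2 by rewrite ler_piMl// subr_ge0 ltW.
have := sqr_ge0 (S1 - s - 2); lra.
Qed.

(** By the inequality of the means the last two terms are at least [mu - eta]. This replaces
    Chebyshev by a pointwise bound; once the variance of [eta] is at most [delta ^ 2], these terms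
    cost [delta] in the mean. *)
Lemma half_le_amgm mu eta delta (b : bool) : 0 < delta -> 1 / 2 <= mu ->
  b%:R / 2 <= b%:R * eta + (eta - mu) ^+ 2 / (2 * delta) + delta / 2.
Proof.
move=> d0 mu2; have d2 : 0 <= 2 * delta by rewrite mulr_ge0// ltW.
case: b => /=; last first.
  rewrite !mul0r add0r addr_ge0 ?divr_ge0 ?sqr_ge0//.
  by rewrite ltW.
have -> : (eta - mu) ^+ 2 / (2 * delta) =
    (eta - mu + delta) ^+ 2 / (2 * delta) + (mu - eta) - delta / 2.
  by field; rewrite lt0r_neq0.
have : 0 <= (eta - mu + delta) ^+ 2 / (2 * delta) by rewrite divr_ge0 ?sqr_ge0.
lra.
Qed.

(** The deterministic core. Later [mu] and [s] are the means of the two sums, so that the squares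
    integrate to variances, and the sum of the [x i * tilted_ramp] terms integrates to 0 by
    independence. *)
Lemma concentration_pointwise (I : finType) (x a' b' : I -> R)
    (a b W mu s delta : R) :
  W = \sum_i x i -> 0 < delta -> 1 / 2 <= mu -> s <= 1 ->
  (a <= W <= b)%R%:R / 2 <=
    (\sum_i trunc_sq delta (x i) - mu) ^+ 2 / (2 * delta) + delta
    + (\sum_i small_sq (x i) - s) ^+ 2 / 16
    + (\sum_i large_sq (x i)) / 4 + (\sum_i x i ^+ 2) * delta / 2
    + 5 / 4 * `|b - a|
    - \sum_i x i * tilted_ramp delta (a' i) (b' i) (W - x i)
    + \sum_i (`|x i * (a - a' i)| + `|x i * (b - b' i)|).
Proof.
move=> WE d0 mu2 s1; have d0' := ltW d0.
pose I0 := Num.min a b <= W <= Num.min a b + gap a b.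
pose g := gap a b + 2 * delta.
have g0 : 0 <= g by rewrite addr_ge0 ?gap_ge0// mulr_ge0.
(* A pointwise Markov inequality: the cut-off changes the event only when [|b - a| > 1], and then
   [|b - a| / 2] alone exceeds the left side. *)
have evI : (a <= W <= b)%R%:R / 2 <= I0%:R / 2 + `|b - a| / 2.
  have [/andP[aW Wb]|_] := boolP (a <= W <= b); last first.
    by rewrite mul0r addr_ge0// divr_ge0// ler0n.
  have ab : a <= b := le_trans aW Wb.
  have [ba1|ba1] := leP `|b - a| 1.
    rewrite /I0 /gap (min_l ab) (min_l ba1) ger0_norm ?subr_ge0//.
    rewrite [a + _]addrC subrK aW Wb/=.
    by rewrite lerDl divr_ge0// subr_ge0.
  by have i0 : 0 <= I0%:R :> R := ler0n _ _; rewrite /=; lra.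
(* Pass from [W] to [W - x i] with the limits fixed, splitting the increment into ramp and tilt,
   then exchange [a], [b] for [a' i], [b' i] by the Lipschitz bound. *)
have stepE i : I0%:R * trunc_sq delta (x i) - x i ^+ 2 * (g / 4)
    + x i * tilted_ramp delta (a' i) (b' i) (W - x i)
    - (`|x i * (a - a' i)| + `|x i * (b - b' i)|) <=
    x i * tilted_ramp delta a b W.
  have h1 : I0%:R * trunc_sq delta (x i) <=
      x i * (ramp delta a b W - ramp delta a b (W - x i)).
    case: (boolP I0) => [h|_]; first by rewrite mul1r ramp_increment_ge.
    by rewrite mul0r ramp_increment_ge0.
  have h2 := ler_wpM2r g0 (tilt_increment_le W (x i)).
  have h3 := tilted_ramp_dist delta a b (a' i) (b' i) (W - x i).
  have {}h3 := ler_wpM2l (normr_ge0 (x i)) h3.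
  rewrite [leRHS]mulrDr -!normrM ler_norml in h3.
  case/andP: h3 => h3 _.
  have -> : x i * tilted_ramp delta a b W =
    x i * (ramp delta a b W - ramp delta a b (W - x i)) -
    x i * (tilt W - tilt (W - x i)) * g + x i * tilted_ramp delta a b (W - x i).
    by rewrite /tilted_ramp -/g; ring.
  lra.
(* Summed over [i], the right sides of [stepE] add up to [W * tilted_ramp delta a b W], which is at
   most [g / 4]. *)
have := ler_sum (index_enum I) (fun i (_ : true) => stepE i).
rewrite -mulr_suml -WE sumrB big_split/= sumrB -mulr_sumr -mulr_suml.
have := mul_tilted_ramp_le d0' a b W; rewrite -/g.
set F := W * _; set D := \sum_i (_ + _); set G := \sum_i x i * _.
set eta := \sum_i _; set S := \sum_i x i ^+ 2 => FW FS.
have := half_le_amgm eta I0 d0 mu2.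
set S1 := \sum_i small_sq _; set S2 := \sum_i large_sq _.
have SE : S = S1 + S2.
  by rewrite /S -big_split; apply: eq_bigr => i _; rewrite /= small_sqD_large_sq.
have S20 : 0 <= S2 by apply: sumr_ge0 => i _; exact: large_sq_ge0.
have gb := gap_le a b.
have gS : gap a b * (S1 + S2) <= 2 * gap a b + (S1 - s) ^+ 2 / 4 + S2.
  by apply: gap_mul_le => //; rewrite gap_ge0 gap_le1.
have gSE : S * (g / 4) = gap a b * (S1 + S2) / 4 + S * delta / 2.
  by rewrite /g SE; field.
rewrite gSE in FS; rewrite /g in FW.
(* The coefficient 5/4 of [|b - a|] is 1/2 from [evI], 1/4 from [FW] and 1/2 from [gS]; that of
   [delta] is 1/2 from the inequality of the means and 1/2 from [FW]. *)
move: evI; set e := _%:R / 2; move: (I0%:R : R) (I0%:R * eta) FS => i0 ie.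
move: ((eta - mu) ^+ 2 / (2 * delta)) (S * delta / 2) => Q1 Q2.
move: ((S1 - s) ^+ 2) gS (`|b - a|) gb => Q3 gS L gb.
move: (gap a b * (S1 + S2)) gS => Q4; lra.
Qed.

End pointwise_bound.

(** * Independence and variance *)

Section independence_lemmas.
Context {d : measure_display} {T : measurableType d} {R : realType}.
Variable P : probability T R.

Lemma independent_pair_comp {d1 d2 d3 d4 : measure_display}
    {T1 : measurableType d1} {T2 : measurableType d2}
    {T3 : measurableType d3} {T4 : measurableType d4}
    (X : T -> T1) (Y : T -> T2) (f : T1 -> T3) (g : T2 -> T4) :
  measurable_fun [set: T1] f -> measurable_fun [set: T2] g ->
  independent_pair P X Y -> independent_pair P (f \o X) (g \o Y).
Proof.
move=> mf mg XY A B mA mB.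
have mfA : measurable (f @^-1` A) by rewrite -(setTI (_ @^-1` _)); exact: mf.
have mgB : measurable (g @^-1` B) by rewrite -(setTI (_ @^-1` _)); exact: mg.
exact: (XY _ _ mfA mgB).
Qed.

Lemma mutually_independent_pair {I : finType} {d' : measure_display}
    {T' : measurableType d'} (X : I -> T -> T') (i j : I) :
  mutually_independent P X -> i != j -> independent_pair P (X i) (X j).
Proof.
move=> indX ij A B mA mB.
pose C k := if k == i then A else B.
have mC k : measurable (C k) by rewrite /C; case: ifP.
have Cj : C j = B by rewrite /C eq_sym (negbTE ij).
have := indX [set i; j]%SET C mC.
rewrite (big_setD1 i) ?set21//= (big_setD1 j)/=; last first.
  by rewrite !inE eqxx orbT andbT eq_sym.
rewrite big1 ?mule1; last by move=> k; rewrite !inE; case: eqP => //= ?; case: eqP.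
rewrite Cj /C eqxx => <-; congr (P _).
apply/seteqP; split => [w [Aw Bw] k /=|w h].
  by rewrite !inE => /orP[]/eqP ->; rewrite ?eqxx// eq_sym (negbTE ij).
have := h i; have := h j; rewrite /= !inE !eqxx/= orbT eq_sym (negbTE ij).
by split; auto.
Qed.

End independence_lemmas.

(** * Real-valued integrals: products of independent variables, variances of sums *)

Section real_expectation.
Context {d : measure_display} {T : measurableType d} {R : realType}.
Variable P : probability T R.
Local Notation Int f := (P.-integrable [set: T] (EFin \o f)).
Local Notation E f := (Rintegral P [set: T] f).
Implicit Types X Y : T -> R.

(** The joint law agrees with the product of the marginal laws on rectangles, hence everywhere.
    Tonelli then gives integrability of the product, and Fubini its value. *)
Lemma independent_expectationM X Y : independent_pair P X Y ->
  Int X -> Int Y -> Int (fun w => X w * Y w) /\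
  E (fun w => X w * Y w) = E X * E Y.
Proof.
move=> XY iX iY.
have mX : measurable_fun setT X by apply/measurable_EFinP; exact: measurable_int iX.
have mY : measurable_fun setT Y by apply/measurable_EFinP; exact: measurable_int iY.
have mZ : measurable_fun setT (fun w => (X w, Y w)).
  exact: measurable_fun_pair.
pose X' : {mfun T >-> R} := HB.pack X (isMeasurableFun.Build _ _ _ _ _ mX).
pose Y' : {mfun T >-> R} := HB.pack Y (isMeasurableFun.Build _ _ _ _ _ mY).
pose Z' : {mfun T >-> (R * R)%type} :=
  HB.pack (fun w => (X w, Y w)) (isMeasurableFun.Build _ _ _ _ _ mZ).
pose muX := distribution P X'; pose muY := distribution P Y'.
pose muZ := distribution P Z'.
have muE A : measurable A -> (muX \x muY)%E A = muZ A.
  apply: product_measure_unique => B C.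
  by move=> mB mC; rewrite -[RHS]XY.
have eqZ (f : R * R -> \bar R) :
    (\int[muX \x muY]_z f z = \int[muZ]_z f z)%E.
  by apply: eq_measure_integral => A mA _; exact: muE.
have mid : measurable_fun setT (EFin : R -> \bar R) by exact/measurable_EFinP.
have iX' : muX.-integrable setT (EFin : R -> \bar R).
  exact: (integrable_pushforward mX mid iX measurableT).
have iY' : muY.-integrable setT (EFin : R -> \bar R).
  exact: (integrable_pushforward mY mid iY measurableT).
pose f (z : R * R) := (z.1 * z.2)%:E : \bar R.
have mf : measurable_fun setT f.
  by apply/measurable_EFinP; exact: measurable_funM.
have aX : (\int[muX]_x `|x%:E| < +oo)%E by case/integrableP : iX'.
have aY : (\int[muY]_x `|x%:E| < +oo)%E by case/integrableP : iY'.
have aXfin : (\int[muX]_x `|x%:E| \is a fin_num)%E.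
  by rewrite ge0_fin_numE//; exact: integral_ge0.
have if' : (muX \x muY)%E.-integrable setT f.
  apply/(integrable12ltyP _ _ mf).
  have -> : (\int[muX]_x \int[muY]_y `|f (x, y)| =
      \int[muX]_x `|x%:E| * \int[muY]_y `|y%:E|)%E.
    rewrite -ge0_integralZr//; last 2 first.
      exact: measurableT_comp.
      exact: integral_ge0.
    apply: eq_integral => x _; rewrite -ge0_integralZl//; last first.
      exact: measurableT_comp.
    by apply: eq_integral => y _; rewrite /f/= normrM EFinM.
  by rewrite lte_mul_pinfty//; exact: integral_ge0.
have iXY : Int (fun w => X w * Y w).
  apply/integrableP; split.
    by apply/measurable_EFinP; exact: measurable_funM.
  case/integrableP : if' => _; rewrite eqZ ge0_integral_distribution//.
  exact: measurableT_comp.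
split=> //; rewrite /Rintegral -fineM; last 2 first.
- exact: integrable_fin_num.
- exact: integrable_fin_num.
congr fine.
rewrite -(@integral_distribution _ _ _ _ _ P Z' f mf iXY) -eqZ.
rewrite -(integral12_prod_meas1 if') /fubini_F.
rewrite -(@integral_distribution _ _ _ _ _ P X' EFin mid iX).
rewrite -(@integral_distribution _ _ _ _ _ P Y' EFin mid iY).
under eq_integral do under eq_integral do rewrite /f/= EFinM.
under eq_integral do rewrite integralZl//.
rewrite -[X in (_ * X)%E]fineK; last exact: integrable_fin_num.
by rewrite -integralZr// fineK//; exact: integrable_fin_num.
Qed.

Lemma integrableRD X Y : Int X -> Int Y -> Int (fun w => X w + Y w).
Proof. exact: integrableD. Qed.

Lemma integrableRB X Y : Int X -> Int Y -> Int (fun w => X w - Y w).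
Proof. exact: integrableB. Qed.

Lemma integrableRZ (k : R) X : Int X -> Int (fun w => k * X w).
Proof. exact: integrableZl. Qed.

Lemma integrableR_cst (k : R) : Int (fun=> k).
Proof. exact: finite_measure_integrable_cst. Qed.

Lemma integrableR_sum (I : Type) (s : seq I) (X : I -> T -> R) :
  (forall i, Int (X i)) -> Int (fun w => \sum_(i <- s) X i w).
Proof.
move=> iX; rewrite (_ : _ \o _ = (fun w => \sum_(i <- s) (EFin \o X i) w)%E).
  exact: integrable_sum.
by apply/funext => w; rewrite /= sumEFin.
Qed.

Lemma le_integrableR X Y : measurable_fun [set: T] X -> Int Y ->
  (forall w, `|X w| <= `|Y w|) -> Int X.
Proof.
move=> mX iY XY; apply: (le_integrable _ _ _ iY) => //; first exact/measurable_EFinP.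
by move=> w _; rewrite lee_fin.
Qed.

Lemma Rintegral_sum (I : Type) (s : seq I) (X : I -> T -> R) :
  (forall i, Int (X i)) ->
  E (fun w => \sum_(i <- s) X i w) = \sum_(i <- s) E (X i).
Proof.
move=> iX; elim: s => [|i s IH].
  rewrite big_nil; under eq_Rintegral do rewrite big_nil.
  by rewrite Rintegral_cst// mul0r.
rewrite big_cons -IH -RintegralD//; last exact: integrableR_sum.
by apply: eq_Rintegral => w _; rewrite big_cons.
Qed.

Lemma Rintegral_probability_cst (k : R) : E (fun=> k) = k.
Proof.
rewrite Rintegral_cst// [X in fine X](_ : _ = 1%E) ?mulr1//.
exact: probability_setT.
Qed.

(** Expand the square of the centred sum: independence cancels the off-diagonal terms, and each
    diagonal term is a second moment less the squared mean. *)
Lemma variance_sum_le (I : finType) (Y : I -> T -> R) :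
  (forall i j, i != j -> independent_pair P (Y i) (Y j)) ->
  (forall i, Int (Y i)) -> (forall i, Int (fun w => Y i w ^+ 2)) ->
  Int (fun w => (\sum_i Y i w - \sum_i E (Y i)) ^+ 2) /\
  E (fun w => (\sum_i Y i w - \sum_i E (Y i)) ^+ 2) <=
    \sum_i E (fun w => Y i w ^+ 2).
Proof.
move=> indY iY iY2.
pose Z i w := Y i w - E (Y i).
have iZ i : Int (Z i) by apply: integrableRB => //; exact: integrableR_cst.
have EZ i : E (Z i) = 0.
  rewrite RintegralB//; last exact: integrableR_cst.
  by rewrite Rintegral_probability_cst subrr.
(* A bound by a conditional in [i == j] makes the double sum collapse to its diagonal. *)
have ZZ i j : Int (fun w => Z i w * Z j w) /\
    E (fun w => Z i w * Z j w) <= if i == j then E (fun w => Y i w ^+ 2) else 0.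
  have [<-|ij] := eqVneq i j.
    have ZE : (fun w => Z i w * Z i w) =
        (fun w => Y i w ^+ 2 + ((- 2 * E (Y i)) * Y i w + E (Y i) ^+ 2)).
      by apply/funext => w; rewrite /Z; ring.
    have i1 : Int (fun w => (- 2 * E (Y i)) * Y i w) by exact: integrableRZ.
    have i2 : Int (fun w => (- 2 * E (Y i)) * Y i w + E (Y i) ^+ 2).
      by apply: integrableRD => //; exact: integrableR_cst.
    rewrite ZE; split; first exact: integrableRD.
    rewrite RintegralD// RintegralD//; last exact: integrableR_cst.
    rewrite RintegralZl// Rintegral_probability_cst.
    by have := sqr_ge0 (E (Y i)); lra.
  have mB (c : R) : measurable_fun [set: R] (fun x : R => x - c).
    exact: measurable_funB.
  have indZ : independent_pair P (Z i) (Z j).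
    exact: (independent_pair_comp (mB _) (mB _) (indY _ _ ij)).
  have [? ->] := independent_expectationM indZ (iZ i) (iZ j).
  by rewrite EZ mul0r.
have sqE : (fun w => (\sum_i Y i w - \sum_i E (Y i)) ^+ 2) =
    (fun w => \sum_i \sum_j Z i w * Z j w).
  apply/funext => w; rewrite -sumrB expr2 mulr_suml.
  by apply: eq_bigr => i _; rewrite mulr_sumr.
have iS i : Int (fun w => \sum_j Z i w * Z j w).
  by apply: integrableR_sum => j; exact: (ZZ i j).1.
rewrite sqE; split; first exact: integrableR_sum.
rewrite Rintegral_sum//; apply: ler_sum => i _.
rewrite Rintegral_sum; last by move=> j; exact: (ZZ i j).1.
apply: le_trans (ler_sum _ (fun j _ => (ZZ i j).2)) _.
by rewrite -big_mkcond/= (big_pred1 i)// => j; rewrite eq_sym.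
Qed.

End real_expectation.

(** * Measurability of the test function and truncations; integrability from second moments *)

Section measurability.
Context {R : realType}.

Lemma measurable_trunc_sq delta : measurable_fun [set: R] (@trunc_sq R delta).
Proof.
apply: measurable_funM; first exact: normr_measurable.
by apply: measurable_minr => //; exact: normr_measurable.
Qed.

Let measurable_normr_le1 : measurable_fun [set: R] (fun x : R => `|x| <= 1).
Proof. by apply: measurable_fun_ler => //; exact: normr_measurable. Qed.

Lemma measurable_small_sq : measurable_fun [set: R] (@small_sq R).
Proof. by apply: measurable_fun_ifT => //; exact: exprn_measurable. Qed.

Lemma measurable_large_sq : measurable_fun [set: R] (@large_sq R).
Proof. by apply: measurable_fun_ifT => //; exact: exprn_measurable. Qed.

Lemma measurable_small_cube : measurable_fun [set: R] (@small_cube R).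
Proof.
apply: measurable_fun_ifT => //.
by apply: measurable_funX; exact: normr_measurable.
Qed.

Lemma measurable_tilted_ramp delta : measurable_fun [set: R * R * R]
  (fun z => tilted_ramp delta z.1.1 z.1.2 z.2).
Proof.
have m11 : measurable_fun [set: R * R * R] (fun z => z.1.1).
  exact: (measurableT_comp measurable_fst measurable_fst).
have m12 : measurable_fun [set: R * R * R] (fun z => z.1.2).
  exact: (measurableT_comp measurable_snd measurable_fst).
have m2 : measurable_fun [set: R * R * R] (fun z => z.2).
  exact: measurable_snd.
have mlen : measurable_fun [set: R * R * R]
    (fun z => gap z.1.1 z.1.2 + 2 * delta).
  apply: measurable_funD => //; apply: measurable_minr => //.
  by apply: measurableT_comp; [exact: normr_measurable|exact: measurable_funB].
apply: measurable_funB; last apply: measurable_funM => //.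
- apply: measurable_maxr => //; apply: measurable_minr => //.
  apply: measurable_funD => //; apply: measurable_funB => //.
  exact: measurable_minr.
- apply: measurable_maxr => //; apply: measurable_minr => //.
  by apply: measurable_funD => //; exact: measurable_funM.
Qed.

End measurability.

Section second_moment.
Context {d : measure_display} {T : measurableType d} {R : realType}.
Variable P : probability T R.
Local Notation Int f := (P.-integrable [set: T] (EFin \o f)).
Variable X : T -> R.
Hypotheses (mX : measurable_fun [set: T] X) (iX2 : Int (fun w => X w ^+ 2)).

(** On a probability space it suffices that [|x| <= 1 + x ^ 2]. *)
Lemma integrableR_of_sqr : Int X.
Proof.
have i1 : Int (fun w => 1 + X w ^+ 2) by apply: integrableRD => //; exact: integrableR_cst.
apply: le_integrableR mX i1 _ => w; rewrite [leRHS]ger0_norm; last first.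
  by rewrite addr_ge0 ?sqr_ge0.
rewrite -[X w ^+ 2]real_normK ?num_real//.
by have := sqr_ge0 (`|X w| - 1 / 2); lra.
Qed.

Lemma le_sqr_integrableR (g : R -> R) (k : R) : measurable_fun [set: R] g ->
  (forall x, 0 <= g x <= k * x ^+ 2) -> Int (fun w => g (X w)).
Proof.
move=> mg gle; apply: (le_integrableR _ (integrableRZ k iX2)); first exact: measurableT_comp.
move=> w; have /andP[g0 gk] := gle (X w).
by rewrite !ger0_norm// (le_trans g0).
Qed.

Lemma integrableR_small_sq : Int (fun w => small_sq (X w)).
Proof.
apply: (@le_sqr_integrableR _ 1); first exact: measurable_small_sq.
move=> x; rewrite small_sq_ge0 mul1r -[x ^+ 2]small_sqD_large_sq.
by rewrite lerDl large_sq_ge0.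
Qed.

Lemma integrableR_large_sq : Int (fun w => large_sq (X w)).
Proof.
apply: (@le_sqr_integrableR _ 1); first exact: measurable_large_sq.
move=> x; rewrite large_sq_ge0 mul1r -[x ^+ 2]small_sqD_large_sq.
by rewrite lerDr small_sq_ge0.
Qed.

Lemma integrableR_small_cube : Int (fun w => small_cube (X w)).
Proof.
apply: (@le_sqr_integrableR _ 1); first exact: measurable_small_cube.
by move=> x; rewrite small_cube_ge0 mul1r small_cube_le.
Qed.

End second_moment.

(** * Taking expectations *)

Section concentration.
Context {d : measure_display} {T : measurableType d} {R : realType}.
Variable P : probability T R.
Local Notation Int f := (P.-integrable [set: T] (EFin \o f)).
Local Notation E f := (Rintegral P [set: T] f).
Variables (I : finType) (xi a' b' : I -> T -> R) (a b W : T -> R).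
Hypothesis WE : forall w, W w = \sum_i xi i w.
Hypothesis mxi : forall i, measurable_fun [set: T] (xi i).
Hypothesis indep : forall i j, i != j -> independent_pair P (xi i) (xi j).
Hypothesis Exi : forall i, E (xi i) = 0.
Hypothesis ixi2 : forall i, Int (fun w => xi i w ^+ 2).
Hypothesis Exi2 : \sum_i E (fun w => xi i w ^+ 2) = 1.
Hypotheses (ma : measurable_fun [set: T] a) (mb : measurable_fun [set: T] b).
Hypothesis ma' : forall i, measurable_fun [set: T] (a' i).
Hypothesis mb' : forall i, measurable_fun [set: T] (b' i).
Hypothesis indep' : forall i,
  independent_pair P (xi i) (fun w => (a' i w, b' i w, W w - xi i w)).
Hypothesis iab : Int (fun w => `|b w - a w|).
Hypothesis ia : forall i, Int (fun w => `|xi i w * (a w - a' i w)|).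
Hypothesis ib : forall i, Int (fun w => `|xi i w * (b w - b' i w)|).

Let beta2 := \sum_i E (fun w => large_sq (xi i w)).
Let beta3 := \sum_i E (fun w => small_cube (xi i w)).

Let ixi i : Int (xi i). Proof. exact: integrableR_of_sqr. Qed.

Let ismall i : Int (fun w => small_sq (xi i w)). Proof. exact: integrableR_small_sq. Qed.

Let ilarge i : Int (fun w => large_sq (xi i w)). Proof. exact: integrableR_large_sq. Qed.

Let icube i : Int (fun w => small_cube (xi i w)).
Proof. exact: integrableR_small_cube. Qed.

Lemma truncated_variance_le :
  Int (fun w => (\sum_i small_sq (xi i w)
    - \sum_i E (fun w => small_sq (xi i w))) ^+ 2)
  /\ E (fun w => (\sum_i small_sq (xi i w)
    - \sum_i E (fun w => small_sq (xi i w))) ^+ 2) <= beta3.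
Proof.
have msmall := @measurable_small_sq R.
have isq i : Int (fun w => small_sq (xi i w) ^+ 2).
  apply: (@le_sqr_integrableR _ _ _ P (xi i) (mxi i) (ixi2 i)
    (fun x => small_sq x ^+ 2) 1).
    exact: measurable_funX.
  move=> x; rewrite sqr_ge0 mul1r.
  exact: le_trans (small_sq_sqr_le x) (small_cube_le x).
have [|? h] := @variance_sum_le _ _ _ P I
  (fun i w => small_sq (xi i w)) _ ismall isq.
  by move=> i j ij; exact: (independent_pair_comp msmall msmall (indep ij)).
split => //; apply: le_trans h _; apply: ler_sum => i _.
by apply: le_Rintegral => // w _; exact: small_sq_sqr_le.
Qed.

Section delta.
Variable delta : R.
Hypothesis delta0 : 0 < delta.

Let itrunc i : Int (fun w => trunc_sq delta (xi i w)).
Proof.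
have mt := measurable_trunc_sq delta.
apply: (le_integrableR _ (integrableRZ delta (ixi i))); first exact: measurableT_comp.
move=> w; rewrite ger0_norm ?trunc_sq_ge0 ?(ltW delta0)// normrM gtr0_norm//.
exact: trunc_sq_le.
Qed.

Let trunc_sqr_le x : trunc_sq delta x ^+ 2 <= delta ^+ 2 * x ^+ 2.
Proof.
rewrite -[x ^+ 2]real_normK ?num_real// -exprMn ler_sqr ?trunc_sq_le//.
  by rewrite nnegrE trunc_sq_ge0// ltW.
by rewrite nnegrE mulr_ge0// ltW.
Qed.

(** Each [trunc_sq] has square at most [delta ^ 2 * x ^ 2], and the second moments of the [xi i] add
    up to 1. *)
Lemma truncation_variance_le :
  Int (fun w => (\sum_i trunc_sq delta (xi i w)
    - \sum_i E (fun w => trunc_sq delta (xi i w))) ^+ 2)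
  /\ E (fun w => (\sum_i trunc_sq delta (xi i w)
    - \sum_i E (fun w => trunc_sq delta (xi i w))) ^+ 2) <= delta ^+ 2.
Proof.
have mt := measurable_trunc_sq delta.
have isq i : Int (fun w => trunc_sq delta (xi i w) ^+ 2).
  apply: (@le_sqr_integrableR _ _ _ P (xi i) (mxi i) (ixi2 i)
    (fun x => trunc_sq delta x ^+ 2) (delta ^+ 2)).
    exact: measurable_funX.
  by move=> x; rewrite sqr_ge0 trunc_sqr_le.
have [|? h] := @variance_sum_le _ _ _ P I
  (fun i w => trunc_sq delta (xi i w)) _ itrunc isq.
  by move=> i j ij; exact: (independent_pair_comp mt mt (indep ij)).
split => //; apply: le_trans h _.
rewrite -[leRHS]mulr1 -Exi2 mulr_sumr; apply: ler_sum => i _.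
rewrite -RintegralZl//; apply: le_Rintegral => //; first exact: integrableRZ.
Qed.

Lemma truncation_mean_ge :
  1 - beta2 - beta3 / (4 * delta) <= \sum_i E (fun w => trunc_sq delta (xi i w)).
Proof.
rewrite -[X in X - beta2]Exi2 /beta2 /beta3 -sumrB mulr_suml -sumrB; apply: ler_sum => i _.
have i1 := integrableRB (ixi2 i) (ilarge i); have i2 := integrableRZ (4 * delta)^-1 (icube i).
have <- : E (fun w => xi i w ^+ 2 - large_sq (xi i w)
    - (4 * delta)^-1 * small_cube (xi i w)) =
    E (fun w => xi i w ^+ 2) - E (fun w => large_sq (xi i w))
    - E (fun w => small_cube (xi i w)) / (4 * delta).
  by rewrite RintegralB// RintegralB// RintegralZl// [X in _ - X]mulrC.
apply: le_Rintegral => //; first exact: integrableRB.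
move=> w _; apply: le_trans (trunc_sq_ge _ delta0).
by rewrite [X in _ <= _ - X]mulrC.
Qed.

Let G i w := tilted_ramp delta (a' i w) (b' i w) (W w - xi i w).

(** [G i] is a bounded function of the triple that is independent of [xi i], and [xi i] has mean
    0. *)
Lemma leave_one_out_orthogonal i :
  Int (fun w => xi i w * G i w) /\ E (fun w => xi i w * G i w) = 0.
Proof.
have mW : measurable_fun [set: T] W.
  by rewrite (_ : W = fun w => \sum_i xi i w); [exact: measurable_sum|exact/funext].
have mz : measurable_fun [set: T] (fun w => (a' i w, b' i w, W w - xi i w)).
  apply: measurable_fun_pair; first exact: measurable_fun_pair.
  exact: measurable_funB.
have mr := measurable_tilted_ramp delta.
have iG : Int (G i).
  apply: (le_integrableR _ (integrableR_cst P (1 + 2 * delta))).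
    exact: (measurableT_comp mr mz).
  move=> w; rewrite [leRHS]ger0_norm ?tilted_ramp_bound ?(ltW delta0)//.
  by rewrite addr_ge0// mulr_ge0// ltW.
have mid : measurable_fun [set: R] (@idfun R) by exact: measurable_id.
have [? ->] := independent_expectationM
  (independent_pair_comp mid mr (indep' i)) (ixi i) iG.
by rewrite Exi mul0r.
Qed.

(** The expectation of twice the pointwise inequality. The four [delta] are one from the variance of
    the truncated sum, two from the explicit term, and one from the sum of squares, whose mean is
    1. *)
Lemma concentration_real : beta2 <= 1 / 4 -> beta3 <= delta ->
  E (fun w => (a w <= W w <= b w)%R%:R) <=
    4 * delta + beta3 / 8 + beta2 / 2 + 5 / 2 * E (fun w => `|b w - a w|)
    + 2 * \sum_i (E (fun w => `|xi i w * (a w - a' i w)|)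
                 + E (fun w => `|xi i w * (b w - b' i w)|)).
Proof.
move=> b2 b3.
set mu := \sum_i E (fun w => trunc_sq delta (xi i w)).
set s := \sum_i E (fun w => small_sq (xi i w)).
(* The two hypotheses enter here: [beta2] and [beta3 / (4 * delta)] each take at most 1/4 from the
   total 1. *)
have mu2 : 1 / 2 <= mu.
  apply: le_trans truncation_mean_ge.
  suff : beta3 / (4 * delta) <= 1 / 4 by lra.
  by rewrite ler_pdivrMr ?mulr_gt0//; lra.
have s1 : s <= 1.
  rewrite -Exi2; apply: ler_sum => i _; apply: le_Rintegral => // w _.
  by rewrite -small_sqD_large_sq lerDl large_sq_ge0.
have [iV VE] := truncation_variance_le; have [iU UE] := truncated_variance_le.
rewrite -/mu in iV VE; rewrite -/s in iU UE.
pose L w := `|b w - a w|.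
pose S2 w := \sum_i large_sq (xi i w).
pose S w := \sum_i xi i w ^+ 2.
pose N w := \sum_i xi i w * G i w.
pose D w := \sum_i (`|xi i w * (a w - a' i w)| + `|xi i w * (b w - b' i w)|).
have iS2 : Int S2 by exact: integrableR_sum.
have iS : Int S by exact: integrableR_sum.
have iN : Int N by apply: integrableR_sum => i; exact: (leave_one_out_orthogonal i).1.
have iDi i : Int (fun w =>
    `|xi i w * (a w - a' i w)| + `|xi i w * (b w - b' i w)|) by exact: integrableRD.
have iD : Int D by exact: integrableR_sum.
have ES2 : E S2 = beta2 by rewrite Rintegral_sum.
have ES : E S = 1 by rewrite Rintegral_sum.
have EN : E N = 0.
  rewrite Rintegral_sum; last by move=> i; exact: (leave_one_out_orthogonal i).1.
  by rewrite big1// => i _; exact: (leave_one_out_orthogonal i).2.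
have ED : E D = \sum_i (E (fun w => `|xi i w * (a w - a' i w)|)
                 + E (fun w => `|xi i w * (b w - b' i w)|)).
  by rewrite Rintegral_sum//; apply: eq_bigr => i _; rewrite RintegralD.
rewrite -ED -ES2 -/L.
set V := fun w => (_ - mu) ^+ 2 in iV VE.
set U := fun w => (_ - s) ^+ 2 in iU UE.
have mW : measurable_fun [set: T] W.
  by rewrite (_ : W = fun w => \sum_i xi i w); [exact: measurable_sum|exact/funext].
have mev : measurable_fun [set: T] (fun w => a w <= W w <= b w).
  by apply: measurable_and; exact: measurable_fun_ler.
have iev : Int (fun w => (a w <= W w <= b w)%R%:R).
  apply: (le_integrableR _ (integrableR_cst P 1)).
    rewrite (_ : (fun w => _) = fun w => if a w <= W w <= b w then 1 else 0).
      exact: measurable_fun_ifT.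
    by apply/funext => w; case: ifP.
  by move=> w; rewrite normr1 normr_nat; case: (_ <= _ <= _); rewrite /= ?ler01.
(* Nested to the right so that the integral can be split off one summand at a time, with [i1] to
   [i7] as integrability of the successive tails. *)
pose RHS w := delta^-1 * V w + (2 * delta + (1 / 8 * U w + (1 / 2 * S2 w
  + (delta * S w + (5 / 2 * L w + (- 2 * N w + 2 * D w)))))).
have i7 : Int (fun w => - 2 * N w + 2 * D w) by apply: integrableRD; exact: integrableRZ.
have i6 : Int (fun w => 5 / 2 * L w + (- 2 * N w + 2 * D w)).
  by apply: integrableRD => //; exact: integrableRZ.
have i5 : Int (fun w => delta * S w + (5 / 2 * L w + (- 2 * N w + 2 * D w))).
  by apply: integrableRD => //; exact: integrableRZ.
have i4 : Int (fun w => 1 / 2 * S2 w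
  + (delta * S w + (5 / 2 * L w + (- 2 * N w + 2 * D w)))).
  by apply: integrableRD => //; exact: integrableRZ.
have i3 : Int (fun w => 1 / 8 * U w + (1 / 2 * S2 w
  + (delta * S w + (5 / 2 * L w + (- 2 * N w + 2 * D w))))).
  by apply: integrableRD => //; exact: integrableRZ.
have i2 : Int (fun w => 2 * delta + (1 / 8 * U w + (1 / 2 * S2 w
  + (delta * S w + (5 / 2 * L w + (- 2 * N w + 2 * D w)))))).
  by apply: integrableRD => //; exact: integrableR_cst.
have i1 : Int RHS by apply: integrableRD => //; exact: integrableRZ.
have evRHS : E (fun w => (a w <= W w <= b w)%R%:R) <= E RHS.
  apply: le_Rintegral => // w _.
  have := @concentration_pointwise _ I (xi ^~ w) (a' ^~ w) (b' ^~ w)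
    (a w) (b w) (W w) mu s delta (WE w) delta0 mu2 s1.
  rewrite -/(U w) -/(V w) -/(S2 w) -/(S w) -/(N w) -/(D w) -/(L w) /RHS.
  have -> : V w / (2 * delta) = delta^-1 * V w / 2.
    by field; rewrite lt0r_neq0.
  move: (delta^-1 * V w) (U w) (S2 w) (N w) (D w) (L w) => v u s2 m k l.
  rewrite (_ : S w * delta / 2 = delta * S w / 2); last by rewrite [S w * _]mulrC.
  move: (delta * S w) (_%R%:R) => t e; by clear mu2 s1 b2 b3 VE UE; lra.
apply: le_trans evRHS _; rewrite /RHS.
rewrite (RintegralD _ (integrableRZ _ iV) i2)// (RintegralD _ (integrableR_cst _ _) i3)//.
rewrite (RintegralD _ (integrableRZ _ iU) i4)// (RintegralD _ (integrableRZ _ iS2) i5)//.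
rewrite (RintegralD _ (integrableRZ _ iS) i6)// (RintegralD _ (integrableRZ _ iab) i7)//.
rewrite (RintegralD _ (integrableRZ _ iN) (integrableRZ _ iD))//.
rewrite Rintegral_probability_cst !RintegralZl// ES EN.
have : delta^-1 * E V <= delta.
  by rewrite mulrC ler_pdivrMr// -expr2.
move: (delta^-1 * E V) (E U) (E S2) (E L) (E D) UE => v u s2 l k; move: beta3 => c.
by clear mu2 s1 b2 b3 VE ES2 ES EN ED; lra.
Qed.

End delta.
End concentration.

(** * Passage to indicators and extended-real expectations, and the theorem *)

Lemma large_sq_indicE {R : realType} (x : R) :
  x ^+ 2 * \1_[set x : R | 1 < `|x|] x = large_sq x.
Proof.
rewrite indicE /large_sq; case: (leP `|x| 1) => x1.
  by rewrite memNset ?mulr0//= ltNge x1.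
by rewrite mem_set ?mulr1.
Qed.

Lemma small_cube_indicE {R : realType} (x : R) :
  `|x| ^+ 3 * \1_[set x : R | `|x| <= 1] x = small_cube x.
Proof.
rewrite indicE /small_cube; case: (leP `|x| 1) => x1.
  by rewrite mem_set ?mulr1.
by rewrite memNset ?mulr0//= leNgt x1.
Qed.

Section expectation_bridge.
Context {d : measure_display} {T : measurableType d} {R : realType}.
Variable P : probability T R.
Local Notation Int f := (P.-integrable [set: T] (EFin \o f)).
Local Notation E f := (Rintegral P [set: T] f).

Lemma expectation_EFin (X : T -> R) : Int X -> ('E_P[X] = (E X)%:E)%E.
Proof.
by move=> iX; rewrite unlock /Rintegral fineK//; exact: (integrable_fin_num _ iX).
Qed.

Lemma expectation_lty_integrableR (X : T -> R) : measurable_fun [set: T] X ->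
  (forall w, 0 <= X w) -> ('E_P[X] < +oo)%E -> Int X.
Proof.
move=> mX X0; rewrite unlock => EX; apply/integrableP; split.
  exact/measurable_EFinP.
by under eq_integral do rewrite /= ger0_norm//.
Qed.

Lemma sume_fin_term (I : finType) (F : I -> \bar R) (i : I) :
  (forall j, 0 <= F j)%E -> (F i <= \sum_j F j)%E.
Proof.
by move=> F0; rewrite (bigD1 i)//= leeDl// sume_ge0.
Qed.

End expectation_bridge.

Theorem theorem4p1 (R : realType) (d : measure_display) (T : measurableType d)
    (P : probability T R) (n : nat) (xi : 'I_n -> {RV P >-> R})
    (xi_indep : mutually_independent P (fun i => xi i : T -> R))
    (xi_mean : forall i : 'I_n, ('E_P[xi i] = 0)%E)
    (xi_var : (\sum_(i < n) 'E_P[fun w => (xi i w ^+ 2)%R] = 1)%E)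
    (f1 f2 : n.-tuple R -> R)
    (f1_meas : measurable_fun [set: n.-tuple R] f1)
    (f2_meas : measurable_fun [set: n.-tuple R] f2)
    (Delta1' Delta2' : 'I_n -> {RV P >-> R}) :
  let W : T -> R := fun w => \sum_(i < n) xi i w in
  let Delta1 : T -> R := fun w => f1 [tuple xi i w | i < n] in
  let Delta2 : T -> R := fun w => f2 [tuple xi i w | i < n] in
  let beta2 : \bar R := (\sum_(i < n)
    'E_P[fun w => (xi i w ^+ 2 * \1_[set x : R | 1 < `|x|] (xi i w))%R])%E in
  let beta3 : \bar R := (\sum_(i < n)
    'E_P[fun w => (`|xi i w| ^+ 3 * \1_[set x : R | `|x| <= 1] (xi i w))%R])%E in
  (forall i : 'I_n, independent_pair P (xi i)
     (fun w => (Delta1' i w, Delta2' i w, W w - xi i w))) ->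
  (P [set w | (Delta1 w <= W w <= Delta2 w)%R] <=
     17%:E * (beta2 + beta3)
     + 5%:E * 'E_P[fun w => `|Delta2 w - Delta1 w|%R]
     + 2%:E * \sum_(i < n)
         ('E_P[fun w => `|xi i w * (Delta1 w - Delta1' i w)|%R]
          + 'E_P[fun w => `|xi i w * (Delta2 w - Delta2' i w)|%R]))%E.

Proof.
move=> W Delta1 Delta2 beta2 beta3 indep'.
have mxi i : measurable_fun [set: T] (xi i) by exact: measurable_funP.
have mtuple : measurable_fun [set: T] (fun w => [tuple xi i w | i < n]).
  apply/measurable_fun_tnthP => i.
  by rewrite (_ : _ \o _ = xi i)//; apply/funext => w; rewrite /= tnth_mktuple.
have mD1 : measurable_fun [set: T] Delta1 by exact: (measurableT_comp f1_meas mtuple).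
have mD2 : measurable_fun [set: T] Delta2 by exact: (measurableT_comp f2_meas mtuple).
have mW : measurable_fun [set: T] W by exact: measurable_sum.
have mev : measurable_fun [set: T] (fun w => Delta1 w <= W w <= Delta2 w).
  by apply: measurable_and; exact: measurable_fun_ler.
have mA : measurable [set w | Delta1 w <= W w <= Delta2 w].
  by have := mev measurableT [set true] I; rewrite setTI.
have ixi2 i : P.-integrable [set: T] (EFin \o (fun w => xi i w ^+ 2)).
  apply: expectation_lty_integrableR => [|w|].
  - exact: measurable_funX.
  - exact: sqr_ge0.
  (* Each second moment is finite because the non-negative terms add up to 1. *)
  have := sume_fin_term i (fun j => expectation_ge0 P (fun w => sqr_ge0 (xi j w))).
  by rewrite xi_var => h; rewrite (le_lt_trans h) ?ltry.
have ixi i : P.-integrable [set: T] (EFin \o xi i) by exact: integrableR_of_sqr.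
have Exi i : Rintegral P [set: T] (xi i) = 0.
  by have := xi_mean i; rewrite expectation_EFin// => -[].
have Exi2 : \sum_i Rintegral P [set: T] (fun w => xi i w ^+ 2) = 1.
  have := xi_var; under eq_bigr do rewrite expectation_EFin//.
  by rewrite sumEFin => -[].
have ilarge i := integrableR_large_sq (mxi i) (ixi2 i).
have icube i := integrableR_small_cube (mxi i) (ixi2 i).
pose b2 := \sum_i Rintegral P [set: T] (fun w => large_sq (xi i w)).
pose b3 := \sum_i Rintegral P [set: T] (fun w => small_cube (xi i w)).
have beta2E : beta2 = b2%:E.
  rewrite -sumEFin; apply: eq_bigr => i _; rewrite -expectation_EFin//.
  by congr expectation; apply/funext => w; rewrite large_sq_indicE.
have beta3E : beta3 = b3%:E.
  rewrite -sumEFin; apply: eq_bigr => i _; rewrite -expectation_EFin//.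
  by congr expectation; apply/funext => w; rewrite small_cube_indicE.
have b2_ge0 : 0 <= b2.
  by apply: sumr_ge0 => i _; apply: Rintegral_ge0 => w _; exact: large_sq_ge0.
have b3_ge0 : 0 <= b3.
  by apply: sumr_ge0 => i _; apply: Rintegral_ge0 => w _; exact: small_cube_ge0.
rewrite beta2E beta3E -EFinD -EFinM.
set L := expectation P (fun w => `|Delta2 w - _|); set S := \sum_(i < n) _.
pose D1 i := ('E_P[fun w => `|xi i w * (Delta1 w - Delta1' i w)|%R])%E.
pose D2 i := ('E_P[fun w => `|xi i w * (Delta2 w - Delta2' i w)|%R])%E.
have L0 : (0 <= L)%E by exact: expectation_ge0.
have D10 i : (0 <= D1 i)%E by exact: expectation_ge0.
have D20 i : (0 <= D2 i)%E by exact: expectation_ge0.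
have S0 : (0 <= S)%E by apply: sume_ge0 => i _; exact: (adde_ge0 (D10 i) (D20 i)).
have nonneg : (0 <= 5%:E * L + 2%:E * S)%E.
  by rewrite adde_ge0// mule_ge0// lee_fin.
(* A probability is at most 1, which settles the case [17 * (b2 + b3) >= 1]. In the other case
   [b2 < 1 / 17], as needed for [b2 <= 1 / 4]. *)
have [b17|b17] := leP 1 (17 * (b2 + b3)).
  apply: (@le_trans _ _ 1%E); first exact: probability_le1.
  rewrite -addeA -[leLHS]adde0; apply: leeD => //.
have neNy (x : \bar R) : (0 <= x)%E -> x != -oo%E by case: x.
have S20 : (0 <= 2%:E * S)%E by rewrite mule_ge0// lee_fin.
(* An infinite error term makes the right side [+oo]; once [L] and [S] are finite, all error terms
   are integrable. *)
have [->|Lfin] := eqVneq L +oo%E.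
  by rewrite gt0_muley ?lte_fin// addey// addye ?leey// neNy.
have [->|Sfin] := eqVneq S +oo%E.
  rewrite gt0_muley ?lte_fin// addey ?leey// neNy// adde_ge0 ?mule_ge0 ?lee_fin//.
  by rewrite mulr_ge0// addr_ge0.
have D1S i : (D1 i <= S)%E.
  apply: (@le_trans _ _ (D1 i + D2 i)%E); first by rewrite leeDl.
  by apply: (sume_fin_term i (F := fun i => (D1 i + D2 i)%E)) => j; exact: adde_ge0.
have D2S i : (D2 i <= S)%E.
  apply: (@le_trans _ _ (D1 i + D2 i)%E); first by rewrite leeDr.
  by apply: (sume_fin_term i (F := fun i => (D1 i + D2 i)%E)) => j; exact: adde_ge0.
have iL : P.-integrable [set: T] (EFin \o (fun w => `|Delta2 w - Delta1 w|)).
  apply: expectation_lty_integrableR => //; last by rewrite ltey.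
  by apply: measurableT_comp; [exact: normr_measurable|exact: measurable_funB].
have iD1 i : P.-integrable [set: T]
    (EFin \o (fun w => `|xi i w * (Delta1 w - Delta1' i w)|)).
  apply: expectation_lty_integrableR => //; last by rewrite (le_lt_trans (D1S i))// ltey.
  apply: measurableT_comp; first exact: normr_measurable.
  by apply: measurable_funM => //; exact: measurable_funB.
have iD2 i : P.-integrable [set: T]
    (EFin \o (fun w => `|xi i w * (Delta2 w - Delta2' i w)|)).
  apply: expectation_lty_integrableR => //; last by rewrite (le_lt_trans (D2S i))// ltey.
  apply: measurableT_comp; first exact: normr_measurable.
  by apply: measurable_funM => //; exact: measurable_funB.
have -> : P [set w | Delta1 w <= W w <= Delta2 w] =
    (Rintegral P [set: T] (fun w => (Delta1 w <= W w <= Delta2 w)%R%:R))%:E.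
  rewrite -[LHS]fineK ?fin_num_measure//; congr (_%:E).
  rewrite -expectation_indic// unlock /Rintegral; congr fine.
  apply: eq_integral => w _; rewrite indicE; congr (_%:R%:E); congr nat_of_bool.
  by apply/idP/idP => [/set_mem|/mem_set].
rewrite /L expectation_EFin//.
have -> : S = (\sum_i (
     Rintegral P [set: T] (fun w => `|xi i w * (Delta1 w - Delta1' i w)|)
   + Rintegral P [set: T] (fun w => `|xi i w * (Delta2 w - Delta2' i w)|)))%:E.
  rewrite -sumEFin; apply: eq_bigr => i _.
  by rewrite EFinD -!expectation_EFin.
rewrite -!EFinM -!EFinD.
(* The slack [e] permits [delta = b2 + b3 + e / 4], which is positive without a separate argument
   that [b2 + b3] is; [4 * delta] then costs exactly [e] more. *)
apply/lee_addgt0Pr => e e0; rewrite -EFinD lee_fin.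
have indep i j : i != j -> independent_pair P (xi i : T -> R) (xi j).
  exact: (mutually_independent_pair xi_indep).
have d0 : 0 < b2 + b3 + e / 4 by rewrite ltr_wpDl ?addr_ge0// divr_gt0.
apply: le_trans (concentration_real (fun w => erefl (W w)) mxi indep Exi ixi2 Exi2
  mD1 mD2 _ _ indep' iL iD1 iD2 d0 _ _) _ => //.
- by rewrite -/b2; lra.
- by rewrite -/b3; lra.
have EL0 : 0 <= Rintegral P [set: T] (fun w => `|Delta2 w - Delta1 w|).
  by apply: Rintegral_ge0 => w _; exact: normr_ge0.
(* In this case the bound obtained has coefficient 9/2 for [b2], 33/8 for [b3] and 5/2 for [EL],
   well within 17, 17 and 5; the coefficient 2 of the leave-one-out errors is attained. *)
rewrite -/b2 -/b3; move: (\sum_i _) (Rintegral _ _ _) EL0 => D EL EL0.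
by clear Exi2 xi_var; lra.
Qed.
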